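(* Let $x$ be sufficiently large, and let $c$ be a real number satisfying $$\frac{(\log\log\log x)^2}{\log\log x}\leq c\leq 1.$$ Then $$\#\{n\leq x: t_n\leq x^c\} = \#\{n\leq x: P^+(n)\leq x^c\} + O\Big(\frac{x}{c\log x}\Big)$$ uniformly in $c$ (that is, the implied constant is absolute), where $n$ ranges over positive integers.
   Context: For a positive integer $n$, $t_n$ is defined as follows: if $n$ is a perfect square then $t_n=0$; otherwise $t_n$ is the least positive integer such that there are integers $1\leq j_1<\cdots<j_s=t_n$ (with $s\ge 1$) for which $n\prod_{i=1}^s(n+j_i)$ is a perfect square. $P^+(n)$ denotes the largest prime factor of $n$, with $P^+(1)=1$. *)

(* Defs.v *)
From mathcomp Require Import all_boot all_order all_algebra.
From mathcomp Require Import all_classical all_reals all_analysis.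

Set Implicit Arguments.
Unset Strict Implicit.
Unset Printing Implicit Defensive.

Import Order.TTheory GRing.Theory Num.Theory.

Definition is_square (m : nat) : Prop := exists k : nat, m = k ^ 2.

(* [path ltn 0 js] says that 0 < j_1 < ... < j_s; together with 0 < t and
   [last 0 js = t] it forces js to be nonempty with largest element t. *)
Definition t_witness (n t : nat) : Prop :=
  0 < t /\
  exists js : seq nat,
    [/\ path ltn 0 js, last 0 js = t & is_square (n * \prod_(j <- js) (n + j))].

(* n * (n + 3 n) = (2 n) ^ 2 *)
Lemma t_witness_ex (n : nat) : exists t : nat, `[< t_witness n t >].
Proof.
case: n => [|n].
  exists 1; apply/asboolP; split=> //; exists [:: 1]; split=> //.
  by exists 0; rewrite mul0n.
exists (3 * n.+1); apply/asboolP; split=> //; exists [:: 3 * n.+1]; split=> //.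
exists (2 * n.+1); rewrite big_seq1 -mulSn expnMn -mulnn mulnCA.
by [].
Qed.

Definition t_ (n : nat) : nat :=
  if `[< is_square n >] then 0 else ex_minn (t_witness_ex n).

Definition count_le (R : realType) (x : R) (P : nat -> bool) : nat :=
  \sum_(1 <= n < (Num.truncn x).+1 | P n) 1.

(* Main.v *)
(* Put y = x^c.  If t_n <= y < p = P^+(n), then p^2 divides n, since p divides
   none of n + 1, ..., n + t_n; there are at most sum_(m > y) x / m^2 such n.
   Conversely, the y-smooth n with t_n > y lying in a window of length y have
   linearly independent vectors of exponent parities: in a product of such n
   that is a square, the smallest one has t_n <= y.  Hence each window contains
   at most pi(y) of them, and Chebyshev's bound pi(y) << y / log y concludes. *)
Require Import Defs.
From mathcomp Require Import all_boot all_order all_algebra.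
From mathcomp Require Import all_classical all_reals all_analysis.
From mathcomp Require Import zify ring lra.

Set Implicit Arguments.
Unset Strict Implicit.
Unset Printing Implicit Defensive.

Import Order.TTheory GRing.Theory Num.Theory.

(** * Squares and the parities of prime exponents *)

Lemma is_square_of_even_logn (m : nat) :
  0 < m -> (forall p, prime p -> odd (logn p m) = false) -> is_square m.
Proof.
move=> m_gt0 ev; exists (\prod_(p <- primes m) p ^ (logn p m)./2).
rewrite -mulnn -big_split /= [LHS]prod_prime_decomp // prime_decompE big_map /=.
apply: eq_big_seq => p; rewrite mem_primes => /and3P[pp _ pm].
by rewrite -expnD addnn -[in LHS](odd_double_half (logn p m)) ev.
Qed.

Lemma is_square_logn_odd (m p : nat) : is_square m -> odd (logn p m) = false.
Proof. by case=> k ->; rewrite lognX mul2n odd_double. Qed.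

Lemma odd_logn_prod (p : nat) (I : Type) (r : seq I) (P : pred I) (F : I -> nat) :
  (forall i, 0 < F i) ->
  odd (logn p (\prod_(i <- r | P i) F i)) =
  \big[addb/false]_(i <- r | P i) odd (logn p (F i)).
Proof.
move=> F_gt0.
(* Positivity of the product is carried through the induction because [lognM] needs it. *)
suff [] : 0 < \prod_(i <- r | P i) F i /\
  odd (logn p (\prod_(i <- r | P i) F i)) =
  \big[addb/false]_(i <- r | P i) odd (logn p (F i)) by [].
elim/big_ind2: _ => [|m a n b [m0 <-] [n0 <-]|i _]; rewrite ?logn1 //.
by split; [rewrite muln_gt0 m0|rewrite lognM // oddD].
Qed.

(** * The function [t_] and square products inside a window *)

Lemma t_leP (n T : nat) :
  reflect (is_square n \/ exists2 t, t <= T & t_witness n t) (t_ n <= T).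
Proof.
rewrite /t_; case: asboolP => [sq|nsq]; first by left; left.
case: ex_minnP => t /asboolP tw tmin; apply: (iffP idP) => [tT|[//|[u uT uw]]].
  by right; exists t.
by apply: leq_trans uT; apply/tmin/asboolP.
Qed.

Lemma dvdn_sqr_of_t_lt (n p : nat) :
  0 < n -> prime p -> p %| n -> t_ n < p -> p ^ 2 %| n.
Proof.
move=> n_gt0 pp pn tp; rewrite pfactor_dvdn //.
suff ev : odd (logn p n) = false.
  have : 0 < logn p n by rewrite logn_gt0 mem_primes pp n_gt0.
  by case: (logn p n) ev => [|[]].
have /t_leP : t_ n <= p.-1 by rewrite -ltnS prednK ?prime_gt0.
case=> [/is_square_logn_odd //|[t tp1 [_ [js [srt lst /is_square_logn_odd]]]]].
move=> /(_ p); rewrite lognM ?prodn_gt0 // => [|j]; last by rewrite addn_gt0 n_gt0.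
rewrite oddD odd_logn_prod => [|j]; last by rewrite addn_gt0 n_gt0.
rewrite big1_seq ?addbF // => j /andP[_ jjs].
suff /negPf pj : ~~ (p %| n + j) by rewrite lognE pj !andbF.
have j_gt0 : 0 < j by have /allP := order_path_min ltn_trans srt; apply.
rewrite dvdn_addr //; apply/negP => /(dvdn_leq j_gt0); apply/negP; rewrite -ltnNge.
apply: (@leq_ltn_trans t); last by have := prime_gt0 pp; lia.
(* Splitting the increasing list at [j] shows that [j] is at most its last entry [t]. *)
rewrite -lst => {lst}; case/splitPr: jjs srt => s1 s2.
rewrite cat_path last_cat /= => /and3P[_ _]; rewrite (path_sortedE ltn_trans).
case/andP=> /allP al _.
by have := mem_last j s2; rewrite inE => /predU1P[->//|/al/ltnW].
Qed.

Lemma t_le_of_path (n T : nat) (js : seq nat) :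
  path ltn 0 js -> last 0 js <= T ->
  is_square (n * \prod_(j <- js) (n + j)) -> t_ n <= T.
Proof.
move=> srt lst sq; apply/t_leP; case: js srt lst sq => [_ _|j js srt lst sq].
  by rewrite big_nil muln1; left.
right; exists (last 0 (j :: js)) => //; split; last by exists (j :: js).
have /allP := order_path_min ltn_trans srt; apply.
by rewrite /= mem_last.
Qed.

(** The least element [m] of [D] singles out the factor [a + m]; the other elements of [D], shifted
    down by [m], are the offsets [j] of a witness. *)
Lemma t_le_of_is_square_prod (a T m : nat) (D : pred nat) :
  m < T -> D m -> (forall i, i < m -> ~~ D i) ->
  is_square (\prod_(0 <= i < T | D i) (a + i)) -> t_ (a + m) <= T.
Proof.
move=> mT Dm Dmin sq.
pose js := [seq j <- index_iota 1 (T - m) | D (j + m)].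
have srt : path ltn 0 js.
  apply: path_filter; first exact: ltn_trans.
  exact: (iota_ltn_sorted 0 (T - m - 1).+1).
apply: (t_le_of_path srt).
  (* The last entry is either the default 0 or an element of [js], hence below [T - m]. *)
  have := mem_last 0 js; rewrite inE mem_filter mem_index_iota.
  by case/predU1P => [->//|/and3P[_ _ /ltnW/leq_trans]]; apply; apply: leq_subr.
suff <- : \prod_(0 <= i < T | D i) (a + i) = (a + m) * \prod_(j <- js) (a + m + j).
  by [].
rewrite (@big_cat_nat _ _ _ m) //=; last exact: ltnW.
rewrite big_nat_cond big1 ?mul1n => [|i]; last first.
  by case/andP=> im Di; have := Dmin i im; rewrite Di.
rewrite big_ltn_cond // Dm big_filter -[m.+1]add1n big_addn; congr (_ * _).
by apply: eq_bigr => j _; rewrite -addnA (addnC m).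
Qed.

(** Linear independence over the field with two elements is replaced by counting: an injection
    between power sets gives [2 ^ #|B| <= 2 ^ #|Q|]. *)
Lemma card_smooth_large_t (a T : nat) : 0 < a ->
  #|[set i : 'I_T | (max_pdiv (a + i) <= T) && (T < t_ (a + i))]|
    <= #|[set p : 'I_T.+1 | prime p]|.
Proof.
move=> a_gt0; set B := [set i | _]; set Q := [set p : 'I_T.+1 | _].
have ai_gt0 (i : nat) : 0 < a + i by rewrite addn_gt0 a_gt0.
pose par p (S : {set 'I_T}) := \big[addb/false]_(i in S) odd (logn p (a + i)).
(* Subsets of B are mapped injectively to sets of primes up to T: two subsets
   with equal images have a symmetric difference D with square product. *)
pose parity (S : {set 'I_T}) := [set p in Q | par (val p) S].
suff inj : {in powerset B &, injective parity}.
  rewrite -(leq_exp2l _ _ (ltnSn 1)) -!card_powerset -(card_in_imset inj).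
  apply/subset_leq_card/fintype.subsetP => _ /imsetP[S _ ->].
  by rewrite powersetE; apply/fintype.subsetP => p; rewrite inE => /andP[].
move=> S S'; rewrite !powersetE => SB SB' eq_par.
pose D := [set i | (i \in S) (+) (i \in S')].
have DB : D \subset B.
  apply/fintype.subsetP => i; rewrite inE.
  by case: (boolP (i \in S)) => [/(fintype.subsetP SB)//|_] /(fintype.subsetP SB').
have sq : is_square (\prod_(i in D) (a + i)).
  apply: is_square_of_even_logn => [|p pp]; first exact: prodn_gt0.
  rewrite odd_logn_prod //; have [pT|Tp] := leqP p T; last first.
    (* By smoothness, a prime above [T] divides no factor of the product. *)
    apply: big1 => i /(fintype.subsetP DB); rewrite inE => /andP[iT _].
    rewrite lognE pp ai_gt0 /=; case: ifP => // pai.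
    suff : p <= max_pdiv (a + i) by lia.
    by apply: max_pdiv_max; rewrite mem_primes pp ai_gt0.
  have -> : \big[addb/false]_(i in D) odd (logn p (a + i)) = par p S (+) par p S'.
    rewrite /par big_mkcond [X in _ = X (+) _]big_mkcond.
    rewrite [X in _ = _ (+) X]big_mkcond -big_split; apply: eq_bigr => i _.
    by rewrite inE; case: (i \in S); case: (i \in S'); rewrite /= ?addbF ?addbb.
  have /setP/(_ (Ordinal (pT : p < T.+1))) := eq_par.
  by rewrite !inE /= pp /= => ->; rewrite addbb.
apply/setP => i0; case: (boolP (i0 \in D)) => [i0D|]; last first.
  by rewrite inE; case: (i0 \in S); case: (i0 \in S').
(* [D] cannot be nonempty: its least element [m] would satisfy [t_ (a + m) <= T], against membership
   in [B]. *)
have [m mD mmin] := arg_minnP val i0D.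
have := fintype.subsetP DB _ mD; rewrite inE ltnNge => /andP[_ /negP[]].
have mem_val (i : 'I_T) : (val i \in map val (enum D)) = (i \in D).
  by rewrite mem_map ?mem_enum //; apply: val_inj.
apply: (@t_le_of_is_square_prod _ _ _ (mem (map val (enum D)))) => //.
- by rewrite /= mem_val.
- move=> i im; apply/negP => /mapP[j]; rewrite mem_enum => jD ij.
  by have := mmin j jD; rewrite -ij leqNgt im.
- rewrite big_mkord; under eq_bigl => i do rewrite /= mem_val.
  exact: sq.
Qed.

(** * Chebyshev's upper bound through the product of primes *)

Lemma prod_primes_dvdn (r : seq nat) (n : nat) :
  uniq r -> (forall p, p \in r -> prime p /\ p %| n) -> \prod_(p <- r) p %| n.
Proof.
elim: r => [|q r IHr] /=; first by rewrite big_nil dvd1n.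
case/andP=> qr ur pr_r; rewrite big_cons.
have [pq qn] := pr_r q (mem_head q r).
have {}IHr : \prod_(p <- r) p %| n.
  by apply: IHr => // p pr; apply: pr_r; rewrite inE pr orbT.
rewrite Gauss_dvd ?qn // prime_coprime // Euclid_dvd_prod // big_has.
apply/negP => /hasP[p pr /=]; have [pp _] := pr_r p (@mem_behead _ (q :: r) p pr).
by rewrite dvdn_prime2 // => /eqP qp; rewrite qp pr in qr.
Qed.

Lemma prime_dvdn_fact (p m : nat) : prime p -> p %| m`! -> p <= m.
Proof.
move=> pp; elim: m => [|m IHm]; first by rewrite Euclid_dvd1.
by rewrite factS Euclid_dvdM // => /orP[/dvdn_leq|/IHm /leqW] //; apply.
Qed.

(** The two equal middle coefficients both occur in the expansion of [(1 + 1) ^ (2m + 1)]. *)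
Lemma bin_odd_middle_le (m : nat) : 'C(m.*2.+1, m) <= 4 ^ m.
Proof.
rewrite -(leq_pmul2l (ltn0Sn 1)) -[2 * 4 ^ m]/(2 * (2 ^ 2) ^ m) -expnM mul2n -expnS.
rewrite mul2n -addnn -[X in X + _]bin_sub; last by lia.
have -> : m.*2.+1 - m = m.+1 by lia.
rewrite -[2 in X in _ <= X]/(1 + 1) Pascal.
have mlt : m < m.*2.+2 by lia.
have m1lt : m.+1 < m.*2.+2 by lia.
rewrite (bigD1 (Ordinal m1lt)) //= (bigD1 (Ordinal mlt)) /=; last first.
  by rewrite -val_eqE /=; lia.
by rewrite !exp1n !muln1 addnA leq_addr.
Qed.

(** Erdős's argument by strong induction: an even number above 2 adds no prime, and for [2m + 1] the
    primes above [m + 1] have a product dividing ['C(2m + 1, m)], which is at most [4 ^ m]. *)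
Lemma primorial_le (n : nat) : \prod_(1 <= p < n.+1 | prime p) p <= 4 ^ n.
Proof.
elim/ltn_ind: n => -[|[|n]] IHn; first by rewrite big_geq.
  by rewrite unlock.
have [odd_n|even_n] := boolP (odd n); last first.
  have [->|n_gt0] := posnP n; first by rewrite unlock.
  rewrite big_mkcond big_nat_recr //= -big_mkcond ifF ?muln1.
    by apply: leq_trans (IHn _ _) _ => //; rewrite leq_exp2l.
  apply/negP => /even_prime[|]; first lia.
  by rewrite /= !negbK (negPf even_n).
have [m n_eq] : exists m, n.+2 = m.*2.+1 by exists n./2.+1; lia.
rewrite n_eq (@big_cat_nat _ _ _ m.+2) /=; [|lia|lia].
rewrite [m.*2.+1 in X in _ <= X](_ : _ = m.+1 + m) ?expnD; last by lia.
apply: leq_mul; first by apply: IHn; lia.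
apply: leq_trans (bin_odd_middle_le m); rewrite dvdn_leq ?bin_gt0 //; first by lia.
rewrite -big_filter; apply: prod_primes_dvdn.
  by rewrite filter_uniq // iota_uniq.
move=> p; rewrite mem_filter mem_index_iota => /and3P[pp mp pm]; split => //.
(* The right factor is [(2m + 1)!]; since [p] exceeds [m + 1], it divides neither [m!] nor
   [(m + 1)!]. *)
have : p %| 'C(m.*2.+1, m) * (m`! * (m.*2.+1 - m)`!).
  by rewrite bin_fact ?dvdn_fact //; lia.
rewrite !Euclid_dvdM // => /or3P[//||] /(prime_dvdn_fact pp); lia.
Qed.

Lemma count_nat_le (m n : nat) (P : pred nat) :
  \sum_(m <= i < n | P i) 1 <= n - m.
Proof. by rewrite sum1_count (leq_trans (count_size _ _)) // size_iota. Qed.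

(** Each prime in [(k, n]] contributes at least [k + 1] to the primorial, and at most [k] primes lie
    below. The cut [k] will be about the square root of [n]. *)
Lemma count_prime_exp_le (n k : nat) :
  k.+1 ^ (\sum_(1 <= p < n.+1 | prime p) 1) <= 4 ^ n * k.+1 ^ k.
Proof.
have [nk|kn] := leqP n k.
  apply: leq_trans (leq_pmull _ _); last by rewrite expn_gt0.
  rewrite leq_pexp2l // (leq_trans (count_nat_le _ _ _)) //.
  by rewrite subSS subn0.
rewrite (@big_cat_nat _ _ _ k.+1) //=; last exact: leqW.
rewrite addnC expnD leq_mul //; last first.
  by rewrite leq_pexp2l // (leq_trans (count_nat_le _ _ _)) // subSS subn0.
apply: leq_trans (primorial_le n).
rewrite [X in _ <= X](@big_cat_nat _ _ _ k.+1) //=; last exact: leqW.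
rewrite -[X in X <= _]mul1n leq_mul //.
  rewrite big_mkcond prodn_gt0 // => p.
  by case: ifP => // /prime_gt0.
rewrite expn_sum big_nat_cond [X in _ <= X]big_nat_cond.
by apply: leq_prod => p /andP[/andP[]].
Qed.

(** * Counting the exceptional integers up to [N] *)

Lemma count_windows (P : pred nat) (T K : nat) :
  (forall a, 0 < a -> \sum_(a <= i < a + T | P i) 1 <= K) ->
  forall k, \sum_(1 <= n < 1 + k * T | P n) 1 <= k * K.
Proof.
move=> win; elim=> [|k IHk]; first by rewrite big_geq.
rewrite (@big_cat_nat _ _ _ (1 + k * T)) //=; last by rewrite leq_add2l leq_mul.
by rewrite [k.+1 * K]mulSn [K + _]addnC leq_add // mulSn (addnC T) addnA win.
Qed.

Lemma sum_card_ord (n : nat) (P : pred nat) :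
  \sum_(0 <= i < n | P i) 1 = #|[set i : 'I_n | P i]|.
Proof. by rewrite big_mkord sum1dep_card. Qed.

Lemma count_smooth_large_t (N T : nat) : 0 < T ->
  \sum_(1 <= n < N.+1 | (max_pdiv n <= T) && (T < t_ n)) 1
    <= (N %/ T).+1 * \sum_(1 <= p < T.+1 | prime p) 1.
Proof.
move=> T_gt0.
pose P n := (max_pdiv n <= T) && (T < t_ n).
have win a : 0 < a -> \sum_(a <= i < a + T | P i) 1
    <= \sum_(1 <= p < T.+1 | prime p) 1.
  move=> a_gt0; rewrite -{1}[a]add0n big_addn addKn.
  have -> : \sum_(1 <= p < T.+1 | prime p) 1 = \sum_(0 <= p < T.+1 | prime p) 1.
    by rewrite [RHS]big_ltn_cond.
  under eq_bigl => i do rewrite addnC.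
  by rewrite !sum_card_ord; apply: card_smooth_large_t.
(* One window more than the quotient covers the incomplete last one. *)
apply: leq_trans (count_windows win (N %/ T).+1).
rewrite [X in _ <= X](@big_cat_nat _ _ _ N.+1) //= ?leq_addr //.
by rewrite add1n ltnS ltnW -?ltn_divLR.
Qed.

(** Double counting: [N %/ m ^ 2] counts the multiples of [m ^ 2] up to [N], and exchanging the sums
    shows that each [n] satisfying [P] is counted at least once. *)
Lemma count_sqr_dvdn (N T : nat) (P : pred nat) :
  (forall n, 0 < n <= N -> P n -> exists2 m, T < m <= N & m ^ 2 %| n) ->
  \sum_(1 <= n < N.+1 | P n) 1 <= \sum_(T.+1 <= m < N.+1) N %/ m ^ 2.
Proof.
move=> Psqr; under [X in _ <= X]eq_bigr => m _ do rewrite divn_count_dvd.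
rewrite exchange_big_nat /= big_mkcond big_nat_cond [X in _ <= X]big_nat_cond.
apply: leq_sum => n /andP[/andP[n_gt0 nN] _]; case: ifP => // Pn.
have [|m mTN mn] := Psqr n _ Pn; first by rewrite n_gt0.
rewrite (bigD1_seq m) ?iota_uniq //= ?mn // mem_index_iota.
by case/andP: mTN => -> ?.
Qed.

Lemma count_small_t_rough (N T : nat) : 0 < T ->
  \sum_(1 <= n < N.+1 | (t_ n <= T) && (T < max_pdiv n)) 1
    <= \sum_(T.+1 <= m < N.+1) N %/ m ^ 2.
Proof.
move=> T_gt0; apply: count_sqr_dvdn => n /andP[n_gt0 nN] /andP[tT Tp].
exists (max_pdiv n); first by rewrite Tp (leq_trans (max_pdiv_leq n_gt0)).
(* [max_pdiv 1] is 1, which does not exceed [T]; so [n] is not 1 and [max_pdiv n] is prime. *)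
have n_gt1 : 1 < n.
  by case: n n_gt0 {nN tT} Tp => [//|[|//]]; case: T T_gt0.
apply: dvdn_sqr_of_t_lt => //; first exact: max_pdiv_prime.
  exact: max_pdiv_dvd.
exact: leq_ltn_trans Tp.
Qed.

(** * Real estimates and the final bound *)

Local Open Scope ring_scope.

Lemma ln_le_predr (R : realType) (x : R) : 0 < x -> ln x <= x - 1.
Proof.
move=> x_gt0; have -> : ln x = ln (1 + (x - 1)) by congr ln; lra.
by apply: le_ln1Dx; lra.
Qed.

(** With [k] the integer square root of [n], logarithms give [c ln(k+1) <= n ln 4 + k ln(k+1) <= 3n
    + n], and [ln(n+1) <= 2 ln(k+1)] doubles this to [8n]. *)
Lemma count_prime_ln_le (R : realType) (n : nat) :
  (\sum_(1 <= p < n.+1 | prime p) 1)%:R * ln (n.+1%:R : R) <= 8 * n%:R.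
Proof.
set c := (\sum_(_ <= _ < _ | _) _)%N.
have [k /andP[kn nk]] : exists k, (k ^ 2 <= n < k.+1 ^ 2)%N.
  elim: n {c} => [|n [k /andP[kn nk]]]; first by exists 0%N.
  have [nk1|kn1] := ltnP n.+1 (k.+1 ^ 2); first by exists k; rewrite nk1 ltnW.
  by exists k.+1; rewrite kn1 /=; nia.
have lnX (a b : nat) : ln ((a.+1 ^ b)%:R : R) = b%:R * ln a.+1%:R.
  by rewrite natrX lnXn ?ltr0Sn // mulr_natl.
have : ln ((k.+1 ^ c)%:R : R) <= ln ((4 ^ n * k.+1 ^ k)%:R).
  by rewrite ler_ln ?posrE ?ltr0n ?muln_gt0 ?expn_gt0 // ler_nat count_prime_exp_le.
rewrite natrM lnM ?posrE ?ltr0n ?expn_gt0 // !lnX => c_le.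
have ln4 : ln (4%:R : R) <= 3 by have := @ln_le_predr R 4%:R; lra.
have lnk : ln (k.+1%:R : R) <= k%:R.
  by have := @ln_le_predr R k.+1%:R (ltr0Sn _ _); rewrite -natr1; lra.
have lnn : ln (n.+1%:R : R) <= 2 * ln k.+1%:R.
  have <- := lnX k 2.
  by rewrite ler_ln ?posrE ?ltr0n ?expn_gt0 // ler_nat.
have kn' : k%:R * k%:R <= n%:R :> R by rewrite -natrM ler_nat mulnn.
have : k%:R * ln (k.+1%:R : R) <= k%:R * k%:R by rewrite ler_wpM2l.
have : n%:R * ln (4%:R : R) <= n%:R * 3 by rewrite ler_wpM2l.
have : c%:R * ln (n.+1%:R : R) <= c%:R * (2 * ln k.+1%:R) by rewrite ler_wpM2l.
lra.
Qed.

(** After an index shift, [1/(m+1)^2 <= 1/m - 1/(m+1)] and the sum telescopes. *)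
Lemma sum_divn_sqr_le (R : realFieldType) (N T : nat) : (0 < T)%N ->
  (\sum_(T.+1 <= m < N.+1) N %/ m ^ 2)%:R <= N%:R / T%:R :> R.
Proof.
move=> T_gt0.
have [NT|TN] := leqP N T; first by rewrite big_geq // divr_ge0.
rewrite big_add1 /= natr_sum.
apply: (@le_trans _ _ (N%:R * \sum_(T <= m < N) ((m%:R : R)^-1 - m.+1%:R^-1))).
  rewrite mulr_sumr big_nat_cond [leRHS]big_nat_cond; apply: ler_sum => m.
  case/andP=> /andP[Tm mN] _.
  have m_gt0 : 0 < m%:R :> R by rewrite ltr0n (leq_trans T_gt0).
  have m1 : m.+1%:R = m%:R + 1 :> R by rewrite natr1.
  have -> : (m%:R : R)^-1 - m.+1%:R^-1 = (m%:R * m.+1%:R)^-1.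
    by rewrite m1; field; apply/andP; split; lra.
  rewrite ler_pdivlMr ?mulr_gt0 // -!natrM ler_nat.
  apply: leq_trans (leq_trunc_div N (m.+1 ^ 2)).
  by rewrite leq_mul2l -mulnn leq_mul2r leqnSn !orbT.
rewrite (@telescope_sumr_eq _ T N (fun m => - (m%:R : R)^-1)) ?(ltnW TN) //; last first.
  by move=> m _; rewrite opprK addrC.
by rewrite ler_wpM2l // opprK addrC gerBl invr_ge0.
Qed.

(** The integers satisfying both predicates cancel in the difference. *)
Lemma dist_count_le (N : nat) (A B : pred nat) (R : realDomainType) :
  `|(\sum_(1 <= n < N.+1 | A n) 1)%:R - (\sum_(1 <= n < N.+1 | B n) 1)%:R| <=
  (\sum_(1 <= n < N.+1 | A n && ~~ B n) 1)%:R
  + (\sum_(1 <= n < N.+1 | B n && ~~ A n) 1)%:R :> R.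
Proof.
set r := index_iota 1 N.+1; rewrite !sum1_count -natrD.
have cnt (P Q : pred nat) : count P r
    = (count (predI P Q) r + count (fun n => P n && ~~ Q n) r)%N.
  by rewrite -!size_filter -(count_predC Q [seq n <- r | P n]) !size_filter
             !count_filter; congr (_ + _)%N; apply: eq_count => n /=; rewrite andbC.
have := cnt A B; have := cnt B A.
rewrite (@eq_count _ (predI B A) (predI A B)) => [->->|n]; last exact: andbC.
rewrite ler_norml !natrD.
have := ler0n R (count (fun n => A n && ~~ B n) r).
have := ler0n R (count (fun n => B n && ~~ A n) r).
by move=> ? ?; apply/andP; split; lra.
Qed.

Theorem theorem3p1 (R : realType) :
  exists C x0 : R, 0 < C /\
    forall x c : R, x0 <= x ->
      ln (ln (ln x)) ^+ 2 / ln (ln x) <= c -> c <= 1 ->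
      `| (count_le x (fun n => (t_ n)%:R <= x `^ c))%:R
         - (count_le x (fun n => (max_pdiv n)%:R <= x `^ c))%:R |
      <= C * (x / (c * ln x)).
Proof.
(* 17 is 1 for the rough [n] plus 16 for the smooth ones. This [x0] forces [ln (ln (ln x)) >= 1], so
   the lower bound on [c] makes [c] positive. *)
exists 17, (expR (expR (expR 1))); split=> // x c x0x cl c1.
have ln_mono (a b : R) : expR a <= b -> a <= ln b.
  by move=> ab; rewrite -[a]expRK ler_ln ?posrE ?expR_gt0 // (lt_le_trans _ ab) ?expR_gt0.
have lnx := ln_mono _ _ x0x; have lnlnx := ln_mono _ _ lnx.
have lnlnlnx := ln_mono _ _ lnlnx.
have gt0_of_exp (a b : R) : expR a <= b -> 0 < b by apply: lt_le_trans; apply: expR_gt0.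
have x_gt0 := gt0_of_exp _ _ x0x; have lnx_gt0 := gt0_of_exp _ _ lnx.
have c_gt0 : 0 < c.
  apply: lt_le_trans cl; rewrite divr_gt0 ?(gt0_of_exp _ _ lnlnx) //.
  by rewrite exprn_gt0 // (lt_le_trans _ lnlnlnx).
have L_gt0 : 0 < c * ln x by rewrite mulr_gt0.
set y := x `^ c; have y_gt0 : 0 < y by rewrite powR_gt0.
have lny : ln y = c * ln x by rewrite ln_powR.
have y_ge1 : 1 <= y.
  by rewrite -ler_ln ?posrE // ln1 lny ltW.
have yx : y <= x.
  by rewrite -ler_ln ?posrE // lny ler_piMl // ltW.
set T := Num.truncn y; set N := Num.truncn x.
have T_gt0 : (0 < T)%N by rewrite truncn_gt0.
have TN : (T <= N)%N by apply: le_truncn.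
have /andP[_ yT] := truncn_itv (ltW y_gt0); rewrite -/T in yT.
have /andP[Nx _] := truncn_itv (ltW x_gt0); rewrite -/N in Nx.
have T_pos : 0 < T%:R :> R by rewrite ltr0n.
have LlnT : c * ln x <= ln (T.+1%:R : R) by rewrite -lny ler_ln ?posrE ?ltW.
(* This turns the bound [N / T] for the rough [n] into [x / (c ln x)]. *)
have LT : c * ln x <= T%:R.
  by apply: (le_trans LlnT); have := @ln_le_predr R T.+1%:R (ltr0Sn _ _); rewrite -natr1; lra.
have count_leE (f : nat -> nat) : count_le x (fun n => (f n)%:R <= y)
    = (\sum_(1 <= n < N.+1 | (f n <= T)%N) 1)%N.
  by apply: eq_bigl => n; rewrite truncn_ge_nat // ltW.
rewrite !count_leE; apply: (le_trans (dist_count_le _ _ _ _)).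
have -> : 17 * (x / (c * ln x)) = x / (c * ln x) + 16 * (x / (c * ln x)) by ring.
apply: lerD.
  under eq_bigl => n do rewrite -ltnNge.
  apply: le_trans (_ : N%:R / T%:R <= _).
    by apply: le_trans (sum_divn_sqr_le R N T_gt0); rewrite ler_nat count_small_t_rough.
  by rewrite ler_pM ?invr_ge0 // lef_pV2 ?posrE.
under eq_bigl => n do rewrite -ltnNge.
set S := (\sum_(_ <= _ < _ | _) _)%N.
set p := (\sum_(1 <= p < T.+1 | prime p) 1)%N.
(* The factor 2 comes from [(N %/ T + 1) * T <= N + T] and [T <= N]; with the 8 of the prime count
   it yields 16. *)
have S_le : (S * T <= 2 * N * p)%N.
  rewrite (leq_trans (leq_mul (count_smooth_large_t N T_gt0) (leqnn T))) //.
  rewrite -/p mulnAC leq_mul // mulSn mul2n -addnn leq_add //.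
  exact: leq_trunc_div.
have pL : p%:R * (c * ln x) <= 8 * T%:R.
  by apply: le_trans (count_prime_ln_le R T); rewrite ler_wpM2l.
rewrite mulrA ler_pdivlMr // -(ler_pM2r T_pos).
have S_le' : S%:R * T%:R <= 2 * N%:R * p%:R :> R by rewrite -!natrM ler_nat.
have -> : S%:R * (c * ln x) * T%:R = S%:R * T%:R * (c * ln x) by ring.
apply: (le_trans (ler_wpM2r (ltW L_gt0) S_le')).
have Np_ge0 : 0 <= 2 * N%:R :> R by rewrite mulr_ge0.
have := ler_wpM2l Np_ge0 pL; have := ler_wpM2r (ltW T_pos) Nx; lra.
Qed.
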